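(* Consider an RBM with observed variables $X\in\{-1,1\}^n$ as defined in the context, with parameters $d,s,D,\alpha,\gamma$ as defined there. Fix an observed variable $u$ and a subset $S\subseteq[n]\setminus\{u\}$. Suppose that $S$ does not contain the entire MRF neighborhood of $u$. Then there exists a subset $I$ of the MRF neighborhood of $u$ with $|I|\le 2^s$ such that \[\nu_{u,I|S}\ge\frac{1}{(4d)^{2^s}}\left(\frac1d\right)^{2^s(2^s+1)}\frac{4\alpha^2(e^{-2\gamma})^{d+D-1}}{d^{4d}\,2^{d+1}\binom{D}{d-1}\gamma e^{2\gamma}}.\]
   Context: A Restricted Boltzmann Machine (RBM) is a distribution over observed variables $X\in\{-1,1\}^n$ and latent variables $Y\in\{-1,1\}^m$ with $\mathbb{P}(X=x,Y=y)\propto\exp(x^TJy+h^Tx+g^Ty)$, $J\in\mathbb{R}^{n\times m}$, $h\in\mathbb{R}^n$, $g\in\mathbb{R}^m$; $d$ is the maximum over latent $j$ of $|\{i:J_{i,j}\ne0\}|$. The marginal of $X$ is $\mathbb{P}(X=x)\propto\exp(f(x))$, $f(x)=\sum_{j=1}^m\rho(J_j\cdot x+g_j)+h^Tx$, $J_j$ the $j$-th column of $J$, $\rho(t)=\log(e^t+e^{-t})$; write $f(x)=\sum_{T\subseteq[n]}\hat f(T)\chi_T(x)$, $\chi_T(x)=\prod_{i\in T}x_i$. The MRF neighborhood of $u$ is the set of $i\ne u$ with $\hat f(T)\ne 0$ for some $T\ni u,i$. $s$ is the maximum over $u$ of the number of latent $j$ with $J_{i,j}\ne0$ for some $i$ in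 the MRF neighborhood of $u$. $D$ is the maximum size of an MRF neighborhood; $\alpha$ is the minimum of $|\hat f(T)|$ over $T$ with $\hat f(T)\ne0$; $\gamma=\max_{u\in[n]}\sum_{T\ni u}|\hat f(T)|$. For disjoint $\{u\},I,S$: $\nu_{u,I|S}:=\mathbb{E}_{R,G}\big[\mathbb{E}_{X_S}|\mathbb{P}(X_u=R,X_I=G|X_S)-\mathbb{P}(X_u=R|X_S)\mathbb{P}(X_I=G|X_S)|\big]$ with $R$ uniform on $\{-1,1\}$, $G$ uniform on $\{-1,1\}^{|I|}$, independent, and $X_S$ distributed as the marginal of the RBM. *)

(* Defs.v *)
From HB Require Import structures.
From mathcomp Require Import all_boot all_order all_algebra.
From mathcomp Require Import all_classical all_reals all_analysis.
Set Implicit Arguments. Unset Strict Implicit. Unset Printing Implicit Defensive.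
Import Order.TTheory GRing.Theory Num.Theory.
Local Open Scope ring_scope.

Section RBMDefs.
Variable R : realType.

Record RBM (n m : nat) := MkRBM {
  rJ : 'I_n -> 'I_m -> R;
  rh : 'I_n -> R;
  rg : 'I_m -> R }.

(* A +-1 configuration is encoded by booleans: true = +1, false = -1. *)
Definition spin (b : bool) : R := if b then 1 else -1.

Variables n m : nat.
Variable M : RBM n m.

Definition cfg k := {ffun 'I_k -> bool}.

Definition joint_weight (x : cfg n) (y : cfg m) : R :=
  expR (\sum_i \sum_j spin (x i) * rJ M i j * spin (y j)
        + \sum_i rh M i * spin (x i) + \sum_j rg M j * spin (y j)).

Definition partition_fn : R := \sum_(x : cfg n) \sum_(y : cfg m) joint_weight x y.

Definition probX (x : cfg n) : R := (\sum_(y : cfg m) joint_weight x y) / partition_fn.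

Definition rho (t : R) : R := ln (expR t + expR (- t)).

Definition fX (x : cfg n) : R :=
  \sum_j rho (\sum_i rJ M i j * spin (x i) + rg M j) + \sum_i rh M i * spin (x i).

Definition chi (T : {set 'I_n}) (x : cfg n) : R := \prod_(i in T) spin (x i).

Definition fhat (T : {set 'I_n}) : R :=
  (2 ^+ n)^-1 * \sum_(x : cfg n) fX x * chi T x.

Definition nbhd (u : 'I_n) : {set 'I_n} :=
  [set i | (i != u) && [exists T : {set 'I_n}, [&& u \in T, i \in T & fhat T != 0]]].

Definition param_d : nat := \max_(j : 'I_m) #|[set i : 'I_n | rJ M i j != 0%R]|.

Definition param_s : nat :=
  \max_(u : 'I_n) #|[set j : 'I_m | [exists i in nbhd u, rJ M i j != 0%R]]|.

Definition param_D : nat := \max_(u : 'I_n) #|nbhd u|.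

(* minimum of |fhat T| over T with fhat T != 0.  The default value (sum of all
   |fhat T|) dominates every term, so this is exactly the minimum whenever some
   coefficient is nonzero. *)
Definition param_alpha : R :=
  \big[Num.min/(\sum_(T : {set 'I_n}) `|fhat T|)]_(T : {set 'I_n} | fhat T != 0) `|fhat T|.

Definition param_gamma : R :=
  \big[Num.max/0]_(u : 'I_n) \sum_(T : {set 'I_n} | u \in T) `|fhat T|.

Definition probE (E : pred (cfg n)) : R := \sum_(x : cfg n | E x) probX x.

Definition agree (A : {set 'I_n}) (y x : cfg n) : bool := [forall i in A, x i == y i].

Definition condP (E : pred (cfg n)) (S : {set 'I_n}) (x : cfg n) : R :=
  probE (fun z => E z && agree S x z) / probE (agree S x).

(* nu_{u,I|S}: R uniform on {-1,1}, G uniform on {-1,1}^I (encoded as a uniform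
   full configuration, of which only the coordinates in I are used), and
   E_{X_S}[phi(X_S)] = sum_x P(X = x) phi(x_S). *)
Definition nu (u : 'I_n) (I S : {set 'I_n}) : R :=
  2^-1 * \sum_(r : bool) (2 ^+ n)^-1 * \sum_(G : cfg n) \sum_(x : cfg n)
    probX x * `| condP (fun z => (z u == r) && agree I G z) S x
                 - condP (fun z => z u == r) S x * condP (agree I G) S x |.

Definition theorem3_bound : R :=
  let d := param_d in let s := param_s in let D := param_D in
  let a := param_alpha in let c := param_gamma in
  ((4 * d)%:R ^+ (2 ^ s))^-1 * (d%:R^-1) ^+ (2 ^ s * (2 ^ s + 1)) *
  ((4 * a ^+ 2 * (expR (- (2 * c))) ^+ (d + D - 1)) /
   (d%:R ^+ (4 * d) * 2 ^+ (d + 1) * ('C(D, d.-1))%:R * c * expR (2 * c))).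

End RBMDefs.

(* Main.v *)
Require Import Defs.
From HB Require Import structures.
From mathcomp Require Import all_boot all_order all_algebra.
From mathcomp Require Import all_classical all_reals all_analysis.
From mathcomp Require Import ring lra.
Import Order.TTheory GRing.Theory Num.Theory.
Local Open Scope ring_scope.

Set Implicit Arguments.
Unset Strict Implicit.

(* Write [E] for the local field at [u], [Ebar] for its conditional mean given
   [X_S], and [K I] for the mean of |Cov(chi_I, X_u | X_S)|.  Since
   E[X_u | X_{-u}] = tanh E and tanh increases at rate at least exp(-4 gamma) on
   [-gamma, gamma], the mean of Cov(E, X_u | X_S) dominates that of (E - Ebar)^2,
   which is bounded below by averaging over all spin flips inside the
   neighborhood of [u].  Expanding [E] in characters yields a set [T] containing
   [u], with nonzero coefficient, for which [K (T :\ u :\: S)] is large.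

   To shrink the set, condition on the at most [s] latents adjacent to the
   neighborhood: the neighbors become independent, so
   Cov(chi_J, X_u | X_S) = sum_c w_c prod_(i in J) p_i(c) with at most 2^s
   components [c].  Replacing a factor [p_i] by [p_i - p_i(a)] kills the component
   [a], so after using at most 2^s coordinates nothing is left; hence some subset
   [J] with at most 2^s elements satisfies [K I <= 3 ^ #|I| * K J].  This loses
   far less than the stated bound permits. *)

(** * Spin flips, characters of the cube, and the hyperbolic tangent *)

Section Flip.
Variables (R : realType) (n : nat).
Implicit Types (x z : cfg n) (A B T : {set 'I_n}) (i : 'I_n).

Definition flip B x : cfg n := [ffun i => x i (+) (i \in B)].

Definition invariant_at i (F : cfg n -> R) := forall x, F (flip [set i] x) = F x.

Lemma flipK B : involutive (flip B).
Proof. by move=> x; apply/ffunP => i; rewrite !ffunE addbK. Qed.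

Lemma flip1_neq i j x : j != i -> flip [set i] x j = x j.
Proof. by move=> ji; rewrite ffunE inE (negbTE ji) addbF. Qed.

Lemma flip1_eq i x : flip [set i] x i = ~~ x i.
Proof. by rewrite ffunE inE eqxx addbT. Qed.

Lemma spinN b : spin R (~~ b) = - spin R b.
Proof. by case: b; rewrite /spin ?opprK. Qed.

Lemma mul_spin b : spin R b * spin R b = 1.
Proof. by case: b; rewrite /spin ?mulrNN mulr1. Qed.

Lemma normr_spin b : `|spin R b| = 1.
Proof. by case: b; rewrite /spin ?normrN normr1. Qed.

Lemma normr_chi T x : `|chi R T x| = 1.
Proof. by rewrite normr_prod big1 // => i _; exact: normr_spin. Qed.

Lemma mul_chi T x : chi R T x * chi R T x = 1.
Proof. by rewrite -big_split big1 // => i _; exact: mul_spin. Qed.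

Lemma chi_flip1 i T x :
  chi R T (flip [set i] x) = (if i \in T then -1 else 1) * chi R T x.
Proof.
rewrite /chi; case: ifPn => iT.
  rewrite (bigD1 i) //= [in RHS](bigD1 i) //= flip1_eq spinN mulN1r mulNr.
  by congr (- (_ * _)); apply: eq_bigr => j /andP[_ ji]; rewrite flip1_neq.
rewrite mul1r; apply: eq_bigr => j jT; rewrite flip1_neq //.
by apply: contraNneq iT => <-.
Qed.

Lemma chi_flip_disjoint B T x :
  [disjoint T & B] -> chi R T (flip B x) = chi R T x.
Proof.
move=> dTB; apply: eq_bigr => j jT; rewrite ffunE.
by rewrite (disjointFr dTB jT) addbF.
Qed.

Lemma chiS i T x : i \in T -> chi R T x = spin R (x i) * chi R (T :\ i) x.
Proof.
move=> iT; rewrite /chi (bigD1 i) //=; congr (_ * _).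
by apply: eq_bigl => j; rewrite !inE andbC.
Qed.

Lemma sum_flip B (F : cfg n -> R) : \sum_x F (flip B x) = \sum_x F x.
Proof. by rewrite [RHS](reindex_inj (inv_inj (flipK B))). Qed.

Lemma sum_antisym i (F : cfg n -> R) :
  (forall x, F (flip [set i] x) = - F x) -> \sum_x F x = 0.
Proof.
move=> Fi; have := sum_flip [set i] F.
under eq_bigr do rewrite Fi.
by rewrite sumrN => h; lra.
Qed.

(** Toggling the membership of [i] is an involution of [powerset A] that negates the summand, so the
    terms cancel in pairs. *)
Lemma sum_flip_antisym A i (F : cfg n -> R) x :
  i \in A -> (forall z, F (flip [set i] z) = - F z) ->
  \sum_(B in powerset A) F (flip B x) = 0.
Proof.
move=> iA Fi.
pose h B := [set j | (j \in B) (+) (j == i)].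
have hK : involutive h.
  by move=> B; apply/setP => j; rewrite !inE addbK.
have hA B : (h B \in powerset A) = (B \in powerset A).
  rewrite !inE; apply/fintype.subsetP/fintype.subsetP => BA j jB.
    case: (eqVneq j i) => [-> //|ji]; apply: BA.
    by rewrite inE jB (negbTE ji).
  case: (eqVneq j i) => [-> //|ji]; apply: BA.
  by move: jB; rewrite inE (negbTE ji) addbF.
have : \sum_(B in powerset A) F (flip B x) =
       - \sum_(B in powerset A) F (flip B x).
  rewrite [LHS](reindex_inj (inv_inj hK)) -sumrN.
  apply: eq_big => [B|B _]; first exact: hA.
  rewrite -Fi; congr F; apply/ffunP => j; rewrite !ffunE !inE.
  by rewrite addbA.
by move=> h2; lra.
Qed.

(** The sum expands the product over [i] of 1 + x_i z_i, in which a coordinate where [x] and [z]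
    differ contributes a factor 0. *)
Lemma sum_chi_chi x z :
  \sum_T chi R T x * chi R T z = if x == z then 2 ^+ n else 0.
Proof.
transitivity (\prod_i (spin R (x i) * spin R (z i) + 1)).
  rewrite bigA_distr; apply: eq_bigr => T _.
  rewrite -big_split /= big_mkcond /=.
  by apply: eq_bigr => i _; case: ifP.
case: eqP => [->|/eqP xz].
  under eq_bigr do rewrite mul_spin.
  by rewrite prodr_const card_ord.
have /existsP[i xzi] : [exists i, x i != z i].
  apply: contraNT xz; rewrite negb_exists => /forallP h.
  by apply/eqP/ffunP => i; apply/eqP; rewrite -[_ == _]negbK.
rewrite (bigD1 i) //= (_ : _ + 1 = 0) ?mul0r //.
move: xzi; case: (x i) (z i) => [] [] //= _; rewrite /spin; lra.
Qed.

(** The hyperbolic tangent: the mean of a spin [b] of weight exp(b t). *)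
Definition thyp (t : R) := (expR t - expR (- t)) / (expR t + expR (- t)).

Lemma thypE t : thyp t * (expR t + expR (- t)) = expR t - expR (- t).
Proof. by rewrite /thyp mulfVK // gt_eqF // addr_gt0 ?expR_gt0. Qed.

Lemma normr_thyp_le1 t : `|thyp t| <= 1.
Proof.
have p := expR_gt0 t; have q := expR_gt0 (- t).
rewrite ler_norml /thyp ler_pdivlMr ?ler_pdivrMr ?addr_gt0 //; lra.
Qed.

(** With the other spins fixed, spin [i] has mean tanh [a]; concretely, the difference of the two
    summands is odd under the flip of [i]. *)
Lemma sum_tilt i (c a : cfg n -> R) :
  invariant_at i c -> invariant_at i a ->
  \sum_x c x * expR (spin R (x i) * a x) * spin R (x i) =
  \sum_x c x * expR (spin R (x i) * a x) * thyp (a x).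
Proof.
move=> ci ai; apply/eqP; rewrite -subr_eq0 -sumrB; apply/eqP.
apply: (@sum_antisym i) => x.
rewrite ci ai flip1_eq spinN; have := thypE (a x).
case: (x i); rewrite /spin ?opprK ?mulN1r ?mul1r => /(congr1 ( *%R (c x))) h; lra.
Qed.

(** For b <= a, the increment of tanh is 2 (e^(2a) - e^(2b)) / ((1 + e^(2a)) (1 + e^(2b))). Here
    e^(2a) - e^(2b) >= 2 (a - b) e^(2b), and both 1 / (1 + e^(2a)) and e^(2b) / (1 + e^(2b)) are at
    least e^(-2g) / 2. *)
Lemma thyp_increment (g a b : R) : `|a| <= g -> `|b| <= g ->
  expR (- (4 * g)) * (a - b) ^+ 2 <= (a - b) * (thyp a - thyp b).
Proof.
wlog ba : a b / b <= a.
  move=> h ag bg; case: (leP b a) => [/h|/ltW/h]; first exact.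
  by move=> /(_ bg ag); rewrite -[a - b]opprB -[thyp a - _]opprB mulrNN sqrrN.
rewrite !ler_norml => /andP[a1 a2] /andP[b1 b2].
have thD (t : R) : thyp t = 1 - 2 * (1 + expR (2 * t))^-1.
  have := expR_gt0 (2 * t) => e2.
  have e1 := expR_gt0 t.
  have eN : expR (- t) = (expR t)^-1 by rewrite expRN.
  have eD : expR (2 * t) = expR t * expR t.
    by rewrite -expRD; congr expR; ring.
  rewrite /thyp eN eD; field.
  by rewrite -expr2 !gt_eqF // ?addr_gt0 ?exprn_gt0.
have pos (t : R) := expR_gt0 t.
have half (t : R) : - g <= t -> t <= g ->
    expR (- (2 * g)) / 2 <= (1 + expR (2 * t))^-1 /\
    expR (- (2 * g)) / 2 <= expR (2 * t) * (1 + expR (2 * t))^-1.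
  move=> t1 t2.
  have g0 : 0 <= 2 * g by lra.
  have eg : 1 <= expR (2 * g) by apply: le_trans (expR_ge1Dx _); lra.
  have eN (s : R) : expR (- s) = (expR s)^-1 by rewrite expRN.
  have e1 : expR (2 * t) <= expR (2 * g) by rewrite ler_expR; lra.
  have e2 : expR (- (2 * t)) <= expR (2 * g) by rewrite ler_expR; lra.
  have p := pos (2 * t); have q := pos (2 * g).
  rewrite eN -invfM; split.
    by rewrite lef_pV2 ?posrE ?addr_gt0 ?mulr_gt0 //; lra.
  have -> : expR (2 * t) * (1 + expR (2 * t))^-1 = (1 + expR (- (2 * t)))^-1.
    by rewrite eN; field; rewrite !gt_eqF ?addr_gt0.
  by rewrite lef_pV2 ?posrE ?addr_gt0 ?mulr_gt0 //; lra.
have [ha _] := half a a1 a2; have [_ hb] := half b b1 b2.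
have e4 : expR (- (4 * g)) = expR (- (2 * g)) * expR (- (2 * g)).
  by rewrite -expRD; congr expR; ring.
have hm : 2 * (a - b) * expR (2 * b) <= expR (2 * a) - expR (2 * b).
  have -> : expR (2 * a) = expR (2 * (a - b)) * expR (2 * b).
    by rewrite -expRD; congr expR; ring.
  have := expR_ge1Dx (2 * (a - b)); have := pos (2 * b).
  by nra.
have -> : thyp a - thyp b = 2 * (expR (2 * a) - expR (2 * b)) *
   ((1 + expR (2 * a))^-1 * (1 + expR (2 * b))^-1).
  by rewrite !thD; field; rewrite !gt_eqF ?addr_gt0.
rewrite expr2 mulrCA; apply: ler_wpM2l; first lra.
rewrite e4.
set X := (1 + expR (2 * a))^-1 in ha *.
set Y := (1 + expR (2 * b))^-1 in hb *.
set c := expR (- (2 * g)) in ha hb *.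
have c0 : 0 < c by exact: pos.
have Y0 : 0 < Y by rewrite invr_gt0 addr_gt0.
have X0 : 0 < X by rewrite invr_gt0 addr_gt0.
have XY : c / 2 * (c / 2) <= X * (expR (2 * b) * Y) by apply: ler_pM => //; lra.
apply: (@le_trans _ _ (2 * (2 * (a - b) * expR (2 * b)) * (X * Y))).
  have := ler_wpM2l (_ : 0 <= 4 * (a - b)) XY; lra.
by apply: ler_wpM2r; [rewrite mulr_ge0 ?ltW | lra].
Qed.

End Flip.

(** * Signed mixtures of products *)

Section ProductMixture.
Variables (R : realType) (V X Y : finType) (p : V -> Y -> R).
Implicit Types (A : {set Y}) (I J : {set V}) (w : X -> Y -> R).

(** In the application [x] is the observed configuration conditioned on, [y] a latent pattern,
    [w x y] its signed weight, and [p i y] the mean of spin [i] under that pattern. *)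
Definition mixnorm w A J : R :=
  \sum_x `| \sum_(y in A) w x y * \prod_(i in J) p i y |.

(* Subtracting from [p i] its value at [a] removes the component [a] from the
   mixture at the price of the single coordinate [i]. *)
Lemma mixnorm_le w A I e :
  (forall i y, `|p i y| <= 1) ->
  (forall J, J \subset I -> (#|J| <= #|A|)%N -> mixnorm w A J <= e) ->
  mixnorm w A I <= 3 ^+ #|I| * e.
Proof.
move=> p1; move kI: #|I| => k; elim: k => [|k IH] in I kI w A e *.
  move=> h; rewrite mul1r; apply: h => //.
  by rewrite kI.
move=> h; have e0 : 0 <= e.
  by apply: le_trans (h finset.set0 (finset.sub0set _) _);
     rewrite ?cards0 // sumr_ge0.
have [A0|[a aA]] := set_0Vmem A.
  rewrite /mixnorm big1 ?mulr_ge0 ?exprn_ge0 // => x _.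
  by rewrite A0 big_set0 normr0.
have /card_gt0P[i iI] : (0 < #|I|)%N by rewrite kI.
have kIi : #|I :\ i| = k by move: kI; rewrite (cardsD1 i) iI => -[].
have sIi : I :\ i \subset I by exact: subD1set.
(* Write [w * p i] as [w'] plus [p i a] times [w]. The first part vanishes at [a] and costs 2e, the
   second costs e; together they give one factor 3 per coordinate. *)
pose w' x y := w x y * (p i y - p i a).
have prodD J y : i \notin J ->
    \prod_(j in i |: J) p j y = p i y * \prod_(j in J) p j y.
  by move=> iJ; rewrite big_setU1.
have IH1 : mixnorm w A (I :\ i) <= 3 ^+ k * e.
  by apply: IH => // J JI; apply: h; exact: fintype.subset_trans JI sIi.
(* Removing [a] from [A] leaves room to add [i] to [J], so the hypothesis bounds the mixtures of
   both [i |: J] and [J] by [e]. *)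
have IH2 : mixnorm w' (A :\ a) (I :\ i) <= 3 ^+ k * (2 * e).
  apply: IH => // J JI JA.
  have iJ : i \notin J.
    by apply/negP => /(fintype.subsetP JI); rewrite !inE eqxx.
  have cA : #|A| = #|A :\ a|.+1 by rewrite (cardsD1 a) aA.
  apply: (@le_trans _ _ (mixnorm w A (i |: J) + mixnorm w A J)); last first.
    have := h (i |: J); have := h J.
    rewrite finset.subUset finset.sub1set iI cardsU1 iJ cA.
    rewrite (fintype.subset_trans JI sIi).
    move=> /(_ isT) h1 /(_ isT) h2.
    have := h1 (leqW JA); have := h2 JA; lra.
  rewrite /mixnorm -big_split /=; apply: ler_sum => x _.
  have -> : \sum_(y in A :\ a) w' x y * \prod_(j in J) p j y =
      \sum_(y in A) w x y * \prod_(j in i |: J) p j y -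
      p i a * \sum_(y in A) w x y * \prod_(j in J) p j y.
    rewrite mulr_sumr -sumrB [RHS](big_setD1 a) //=.
    rewrite [X in _ = X + _](_ : _ = 0) ?add0r.
      by apply: eq_bigr => y _; rewrite prodD // /w'; ring.
    by rewrite prodD //; ring.
  apply: le_trans (ler_normB _ _) _; rewrite lerD2l normrM.
  by apply: ler_piMl.
apply: (@le_trans _ _ (mixnorm w' (A :\ a) (I :\ i) + mixnorm w A (I :\ i))).
  rewrite /mixnorm -big_split /=; apply: ler_sum => x _.
  have -> : \sum_(y in A) w x y * \prod_(j in I) p j y =
     \sum_(y in A :\ a) w' x y * \prod_(j in I :\ i) p j y +
     p i a * \sum_(y in A) w x y * \prod_(j in I :\ i) p j y.
    apply/eqP; rewrite -subr_eq; apply/eqP.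
    rewrite mulr_sumr -sumrB [LHS](big_setD1 a) //=.
    rewrite [X in X + _ = _](_ : _ = 0) ?add0r.
      apply: eq_bigr => y _.
      by rewrite (big_setD1 i iI) /= /w'; ring.
    by rewrite (big_setD1 i iI) /=; ring.
  apply: le_trans (ler_normD _ _) _; rewrite lerD2l normrM.
  by apply: ler_piMl.
by rewrite exprS; lra.
Qed.

End ProductMixture.

(** * The marginal of the observed spins and its Fourier coefficients *)

Section Marginal.
Variables (R : realType) (n m : nat) (M : RBM R n m).
Implicit Types (x z : cfg n) (y : cfg m) (A B S T : {set 'I_n}) (i u : 'I_n).

Lemma fX_fourier x : fX M x = \sum_T fhat M T * chi R T x.
Proof.
under eq_bigr do rewrite /fhat -mulrA mulr_suml.
rewrite -mulr_sumr exchange_big /=.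
transitivity ((2 ^+ n)^-1 * \sum_z fX M z * (if z == x then 2 ^+ n else 0)).
  rewrite (bigD1 x) //= eqxx [X in _ + X]big1 ?addr0; last first.
    by move=> z /negbTE ->; rewrite mulr0.
  by rewrite mulrCA mulVf ?mulr1 // expf_neq0 // pnatr_eq0.
congr (_ * _); apply: eq_bigr => z _.
by rewrite -sum_chi_chi mulr_sumr; apply: eq_bigr => T _; rewrite mulrA.
Qed.

(** Given the latents [y], the observed spins are independent and spin [i] has this field. *)
Definition visible_field i y : R := \sum_j rJ M i j * spin R (y j) + rh M i.

Lemma joint_weightE x y : joint_weight M x y =
  expR (\sum_i spin R (x i) * visible_field i y + \sum_j rg M j * spin R (y j)).
Proof.
rewrite /joint_weight; congr expR; congr (_ + _).
rewrite -big_split /=; apply: eq_bigr => i _.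
rewrite /visible_field mulrDr mulr_sumr [rh M i * _]mulrC; congr (_ + _).
by apply: eq_bigr => j _; rewrite mulrA.
Qed.

(** Given [x] the latents are independent, so the sum factors into terms e^t + e^(-t) = exp(rho t),
    one per latent. *)
Lemma sum_joint_weight x : \sum_y joint_weight M x y = expR (fX M x).
Proof.
pose t j := \sum_i rJ M i j * spin R (x i) + rg M j.
have -> : expR (fX M x) = expR (\sum_i rh M i * spin R (x i)) *
    \prod_j \sum_(b : bool) expR (spin R b * t j).
  rewrite /fX expRD mulrC expR_sum; congr (_ * _); apply: eq_bigr => j _.
  rewrite big_bool /= mul1r mulN1r /rho lnK //.
  by rewrite posrE addr_gt0 ?expR_gt0.
rewrite bigA_distr_bigA mulr_sumr; apply: eq_bigr => y _.
rewrite -expR_sum -expRD /joint_weight; congr expR.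
rewrite exchange_big /= -addrA addrCA; congr (_ + _).
rewrite -big_split /=; apply: eq_bigr => j _.
rewrite mulrDr mulr_sumr [rg M j * _]mulrC; congr (_ + _).
by apply: eq_bigr => i _; ring.
Qed.

Lemma partition_fnE : partition_fn M = \sum_x expR (fX M x).
Proof. by apply: eq_bigr => x _; exact: sum_joint_weight. Qed.

Lemma partition_fn_gt0 : 0 < partition_fn M.
Proof.
rewrite partition_fnE (bigD1 [ffun=> true]) //=.
by rewrite ltr_pwDl ?expR_gt0 // sumr_ge0 // => x _; rewrite expR_ge0.
Qed.

Lemma probXE x : probX M x = expR (fX M x) / partition_fn M.
Proof. by rewrite /probX sum_joint_weight. Qed.

Lemma probX_gt0 x : 0 < probX M x.
Proof. by rewrite probXE divr_gt0 ?expR_gt0 ?partition_fn_gt0. Qed.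

Lemma sum_probX : \sum_x probX M x = 1.
Proof.
under eq_bigr do rewrite probXE.
by rewrite -mulr_suml -partition_fnE divff // gt_eqF ?partition_fn_gt0.
Qed.

(* Half the change of the potential [fX M] when spin [u] turns from -1 to 1. *)
Definition local_field u x : R :=
  \sum_(T : {set 'I_n} | u \in T) fhat M T * chi R (T :\ u) x.

Lemma fX_local_field u x : fX M x =
  \sum_(T : {set 'I_n} | u \notin T) fhat M T * chi R T x +
  spin R (x u) * local_field u x.
Proof.
rewrite fX_fourier (bigID (fun T : {set 'I_n} => u \in T)) /= addrC.
congr (_ + _); rewrite mulr_sumr; apply: eq_bigr => T uT.
by rewrite (chiS _ _ uT) mulrCA.
Qed.

Lemma local_field_invariant u : invariant_at u (local_field u).
Proof.
move=> x; apply: eq_bigr => T _.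
by rewrite chi_flip1 !inE eqxx mul1r.
Qed.

Lemma sum_fhat_le_gamma u :
  \sum_(T : {set 'I_n} | u \in T) `|fhat M T| <= param_gamma M.
Proof.
exact: (@le_bigmax _ R _ 0
  (fun v : 'I_n => \sum_(T : {set 'I_n} | v \in T) `|fhat M T|)).
Qed.

Lemma param_gamma_ge0 : 0 <= param_gamma M.
Proof. exact: bigmax_ge_id. Qed.

Lemma local_field_le_gamma u x : `|local_field u x| <= param_gamma M.
Proof.
apply: le_trans (sum_fhat_le_gamma u); apply: le_trans (ler_norm_sum _ _ _) _.
by apply: ler_sum => T _; rewrite normrM normr_chi mulr1.
Qed.

(** Only the terms [T] meeting [B] change, each by at most 2 |fhat T|. Charging each to an element
    of [T] in [B] costs at most 2 gamma per flipped spin. *)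
Lemma fX_flip_le B x : fX M (flip B x) <= fX M x + 2 * param_gamma M * #|B|%:R.
Proof.
rewrite -lerBlDl.
apply: (@le_trans _ _ (\sum_(T : {set 'I_n}) \sum_(i in B)
    (if i \in T then 2 * `|fhat M T| else 0))).
  rewrite !fX_fourier -sumrB; apply: ler_sum => T _.
  have [dTB|] := boolP [disjoint T & B].
    by rewrite chi_flip_disjoint // subrr sumr_ge0 // => i _; case: ifP => // _;
       rewrite mulr_ge0.
  rewrite -setI_eq0 => /set0Pn[i]; rewrite inE => /andP[iT iB].
  rewrite (bigD1 i) //= iT.
  apply: (@le_trans _ _ (2 * `|fhat M T|)); last first.
    by rewrite lerDl sumr_ge0 // => j _; case: ifP => // _; rewrite mulr_ge0.
  rewrite -mulrBr; apply: le_trans (ler_norm _) _; rewrite normrM mulrC.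
  apply: ler_wpM2r => //; apply: le_trans (ler_normB _ _) _.
  by rewrite !normr_chi; lra.
rewrite exchange_big /= mulr_natr -sumr_const; apply: ler_sum => i _.
by rewrite -big_mkcond /= -mulr_sumr ler_pM2l // sum_fhat_le_gamma.
Qed.

(** This is [fX_flip_le] started at the flipped configuration. The exponent uses [#|A|] to be
    uniform over all flips inside [A]. *)
Lemma probX_flip_ge A B x : B \subset A ->
  expR (- (2 * param_gamma M * #|A|%:R)) * probX M x <= probX M (flip B x).
Proof.
move=> BA; rewrite !probXE mulrA -expRD ler_pM2r ?invr_gt0 ?partition_fn_gt0 //.
rewrite ler_expR; have := fX_flip_le B (flip B x); rewrite flipK => h.
have : 2 * param_gamma M * #|B|%:R <= 2 * param_gamma M * #|A|%:R.
  rewrite ler_wpM2l ?mulr_ge0 ?param_gamma_ge0 // ler_nat.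
  exact: subset_leq_card.
lra.
Qed.

(** A summand of [fX] that ignores some spin of [T] is orthogonal to [chi T]. Each [rho] term
    depends on at most d spins, and each linear term on one. *)
Lemma fhat_degree_le T : fhat M T != 0 -> (1 < #|T|)%N -> (#|T| <= param_d M)%N.
Proof.
move=> + T1; apply: contraR; rewrite -ltnNge => dT; apply/eqP.
have chi0 (F : cfg n -> R) i : i \in T -> invariant_at i F ->
    \sum_x F x * chi R T x = 0.
  by move=> iT Fi; apply: (@sum_antisym _ _ i) => x; rewrite Fi chi_flip1 iT; ring.
rewrite /fhat; under eq_bigr do rewrite /fX mulrDl !mulr_suml.
rewrite big_split /= exchange_big /= [X in _ + X]exchange_big /=.
rewrite !big1 ?addr0 ?mulr0 // => [i|j] _.
  have /card_gt0P[k] : (0 < #|T :\ i|)%N.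
    by move: T1; rewrite (cardsD1 i); case: (i \in T);
      rewrite ?add1n ?add0n // => /ltnW.
  rewrite !inE => /andP[ki kT].
  apply: (chi0 (fun x => rh M i * spin R (x i)) k) => // x.
  by rewrite flip1_neq // eq_sym.
pose Sj := [set i : 'I_n | rJ M i j != 0].
have /subsetPn[k kT] : ~~ (T \subset Sj).
  apply: contraTN dT => /subset_leq_card; rewrite -leqNgt => /leq_trans; apply.
  exact: (leq_bigmax (F := fun j => #|[set i : 'I_n | rJ M i j != 0]|)).
rewrite inE negbK => /eqP Jk.
apply: (chi0 (fun x => rho (\sum_i rJ M i j * spin R (x i) + rg M j)) k) => // x.
rewrite (eq_bigr (fun i => rJ M i j * spin R (x i))) // => i _.
by case: (eqVneq i k) => [->|ik]; rewrite ?Jk ?mul0r // flip1_neq.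
Qed.

Lemma param_alpha_le T : fhat M T != 0 -> param_alpha M <= `|fhat M T|.
Proof. by move=> fT; apply: bigmin_le_cond. Qed.

Lemma param_alpha_ge0 : 0 <= param_alpha M.
Proof. by apply: le_bigmin => //; rewrite sumr_ge0. Qed.

End Marginal.

(** * Conditional expectation and covariance given X_S, and comparison with [nu] *)

Section Conditioning.
Variables (R : realType) (n m : nat) (M : RBM R n m).
Implicit Types (x z : cfg n) (y : cfg m) (A B I J S T : {set 'I_n}) (i u : 'I_n).
Implicit Types (F G : cfg n -> R).

Lemma agree_refl S x : agree S x x.
Proof. by apply/forall_inP => i _. Qed.

Lemma agreeC S x z : agree S x z = agree S z x.
Proof. by apply: eq_forallb_in => i _; rewrite eq_sym. Qed.

Lemma agree_eq S x z : agree S x z -> agree S x =1 agree S z.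
Proof.
move=> /forall_inP xz t; apply: eq_forallb_in => i iS.
by rewrite (eqP (xz i iS)).
Qed.

Lemma agree_flip1 S x z i : i \notin S -> agree S x (flip [set i] z) = agree S x z.
Proof.
move=> iS; apply: eq_forallb_in => j jS; rewrite flip1_neq //.
by apply: contraNneq iS => <-.
Qed.

Lemma chi_agree S T x z : T \subset S -> agree S x z -> chi R T z = chi R T x.
Proof.
move=> /fintype.subsetP TS /forall_inP xz; apply: eq_bigr => i /TS iS.
by rewrite (eqP (xz i iS)).
Qed.

Definition condE S F x : R :=
  (\sum_(z | agree S x z) probX M z * F z) / probE M (agree S x).

Definition condcov S F G x : R :=
  condE S (fun z => F z * G z) x - condE S F x * condE S G x.

Lemma probE_agree_gt0 S x : 0 < probE M (agree S x).
Proof.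
rewrite /probE (bigD1 x) ?agree_refl //= ltr_pwDl ?probX_gt0 //.
by rewrite sumr_ge0 // => z _; rewrite ltW ?probX_gt0.
Qed.

Lemma condE_agree S F x z : agree S x z -> condE S F x = condE S F z.
Proof.
move=> xz; have e := agree_eq xz; rewrite /condE /probE.
by congr (_ / _); apply: eq_bigl => t; rewrite e.
Qed.

Lemma condE_sum (K : finType) (P : pred K) S (a : K -> R) (F : K -> cfg n -> R) x :
  condE S (fun z => \sum_(k | P k) a k * F k z) x =
  \sum_(k | P k) a k * condE S (F k) x.
Proof.
rewrite /condE; under eq_bigr do rewrite mulr_sumr.
rewrite exchange_big /= mulr_suml; apply: eq_bigr => k _.
rewrite mulrA; congr (_ / _); rewrite mulr_sumr.
by apply: eq_bigr => z _; rewrite mulrCA.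
Qed.

Lemma eq_condE S F G x :
  (forall z, agree S x z -> F z = G z) -> condE S F x = condE S G x.
Proof.
by move=> FG; rewrite /condE; congr (_ / _); apply: eq_bigr => z /FG ->.
Qed.

Lemma condEZ S c F x : condE S (fun z => c * F z) x = c * condE S F x.
Proof.
rewrite /condE mulrA; congr (_ / _); rewrite mulr_sumr.
by apply: eq_bigr => z _; rewrite mulrCA.
Qed.

Lemma condEB S F G x :
  condE S (fun z => F z - G z) x = condE S F x - condE S G x.
Proof.
rewrite /condE -mulrBl; congr (_ / _); rewrite -sumrB.
by apply: eq_bigr => z _; rewrite mulrBr.
Qed.

Lemma normr_condE_le S F x c : (forall z, `|F z| <= c) -> `|condE S F x| <= c.
Proof.
move=> Fc; rewrite /condE normrM normfV [`|probE _ _|]gtr0_norm ?probE_agree_gt0 //.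
rewrite ler_pdivrMr ?probE_agree_gt0 // /probE mulr_sumr.
apply: le_trans (ler_norm_sum _ _ _) _; apply: ler_sum => z _.
by rewrite normrM gtr0_norm ?probX_gt0 // mulrC ler_wpM2r // ltW // probX_gt0.
Qed.

(** The tower rule with an X_S-measurable factor [G]: after exchanging the sums, the weights of the
    configurations agreeing with [z] on [S] cancel the normalization. *)
Lemma sum_condE S F G : (forall x z, agree S x z -> G x = G z) ->
  \sum_x probX M x * (condE S F x * G x) = \sum_x probX M x * (F x * G x).
Proof.
move=> GS.
transitivity (\sum_x \sum_(z | agree S x z)
   probX M x * (probX M z * F z * G z / probE M (agree S z))).
  apply: eq_bigr => x _; rewrite /condE mulr_suml mulr_suml mulr_sumr.
  apply: eq_bigr => z xz; rewrite (GS _ _ xz).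
  have -> : probE M (agree S x) = probE M (agree S z).
    by apply: eq_bigl => t; rewrite (agree_eq xz).
  by ring.
rewrite (exchange_big_dep predT) //=; apply: eq_bigr => z _.
rewrite -mulr_suml.
have -> : \sum_(x | agree S x z) probX M x = probE M (agree S z).
  by apply: eq_bigl => x; rewrite agreeC.
by field; rewrite gt_eqF ?probE_agree_gt0.
Qed.

Lemma sum_condcov S F G : \sum_x probX M x * condcov S F G x =
  \sum_x probX M x * ((F x - condE S F x) * G x).
Proof.
have h1 := @sum_condE S (fun z => F z * G z) (fun=> 1) (fun _ _ _ => erefl).
have h2 := @sum_condE S G (condE S F) (@condE_agree S F).
transitivity (\sum_x probX M x * (condE S (fun z => F z * G z) x * 1) -
              \sum_x probX M x * (condE S G x * condE S F x)).
  by rewrite -sumrB; apply: eq_bigr => x _; rewrite /condcov; ring.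
by rewrite h1 h2 -sumrB; apply: eq_bigr => x _; ring.
Qed.

(** Centering [G] alone suffices, and makes the covariance visibly linear in [F]. *)
Lemma condcovE S F G x :
  condcov S F G x = condE S (fun z => (G z - condE S G x) * F z) x.
Proof.
transitivity (condE S (fun z => F z * G z - condE S G x * F z) x).
  by rewrite condEB condEZ /condcov [condE S G x * _]mulrC.
by apply: eq_condE => z _; ring.
Qed.

Lemma condcov_sum (K : finType) (P : pred K) S (a : K -> R)
    (F : K -> cfg n -> R) G x :
  condcov S (fun z => \sum_(k | P k) a k * F k z) G x =
  \sum_(k | P k) a k * condcov S (F k) G x.
Proof.
rewrite condcovE; under [RHS]eq_bigr do rewrite condcovE.
rewrite -condE_sum; apply: eq_condE => z _.
by rewrite mulr_sumr; apply: eq_bigr => k _; rewrite mulrCA.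
Qed.

(** The character splits over [S]; its part inside [S] is a constant sign once X_S is fixed and
    leaves the absolute value. *)
Lemma normr_condcov_chi S T G x :
  `|condcov S (chi R T) G x| = `|condcov S (chi R (T :\: S)) G x|.
Proof.
rewrite !condcovE -[RHS]mul1r -(normr_chi R (T :&: S) x) -normrM -condEZ.
congr `| _ |; apply: eq_condE => z xz; rewrite mulrCA; congr (_ * _).
rewrite -(chi_agree (finset.subsetIr T S) xz).
by rewrite /chi (big_setID S).
Qed.

Definition cov_norm S u I : R :=
  \sum_x probX M x * `|condcov S (chi R I) (fun z => spin R (z u)) x|.

(** The sum is a product over coordinates: those outside [I] are free and give a factor 2 each,
    those in [I] are forced to match [z]. *)
Lemma sum_agree_chi I z :
  \sum_(G : cfg n) chi R I G * (agree I G z)%:R = 2 ^+ (n - #|I|) * chi R I z.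
Proof.
pose Fn i b : R := if i \in I then spin R b * (z i == b)%:R else 1.
transitivity (\sum_(G : cfg n) \prod_i Fn i (G i)).
  apply: eq_bigr => G _; have [/forall_inP zG|] := boolP (agree I G z).
    rewrite mulr1 /chi big_mkcond; apply: eq_bigr => i _; rewrite /Fn.
    by case: ifP => // iI; rewrite zG // mulr1.
  rewrite negb_forall_in => /exists_inP[i iI /negbTE zG].
  by rewrite mulr0 (bigD1 i) //= /Fn iI zG mulr0 mul0r.
rewrite -(bigA_distr_bigA (fun i b => Fn i b)).
rewrite (bigID (fun i => i \in I)) /= mulrC; congr (_ * _).
  rewrite (eq_bigr (fun=> 2)) => [|i iI]; last first.
    by rewrite big_bool /Fn (negbTE iI).
  rewrite prodr_const; congr (_ ^+ _).
  by rewrite -[X in (X - _)%N]card_ord -(cardC I) addKn; apply: eq_card => i.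
apply: eq_bigr => i iI; rewrite big_bool /Fn iI.
by case: (z i); rewrite /= ?mulr1 ?mulr0 ?addr0 ?add0r.
Qed.

Lemma condPE (E : pred (cfg n)) S x : condP M E S x = condE S (fun z => (E z)%:R) x.
Proof.
rewrite /condP /condE; congr (_ / _).
rewrite /probE big_mkcondl; apply: eq_bigr => z _.
by case: (E z); rewrite ?mulr1 ?mulr0.
Qed.

(** Summing the indicator covariances in [nu] against the signs r chi_I(G) yields Cov(chi_I, X_u |
    X_S), so the triangle inequality applies. There are 2^(n+1) pairs (r, G), and each pattern on
    [I] occurs 2^(n-|I|) times, whence the factor. *)
Lemma cov_norm_le_nu S u I : (2 ^+ (#|I|.+1))^-1 * cov_norm S u I <= nu M u I S.
Proof.
rewrite /nu /cov_norm.
pose q r (G x : cfg n) := condP M (fun z => (z u == r) && agree I G z) S x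
  - condP M (fun z => z u == r) S x * condP M (agree I G) S x.
have spinE b : \sum_(r : bool) spin R r * (b == r)%:R = spin R b.
  by rewrite big_bool; case: b; rewrite /= ?mulr1 ?mulr0 ?addr0 ?add0r.
have key x : \sum_(r : bool) \sum_(G : cfg n) spin R r * chi R I G * q r G x =
    2 ^+ (n - #|I|) * condcov S (chi R I) (fun z => spin R (z u)) x.
  transitivity (\sum_(r : bool) spin R r * (\sum_(G : cfg n) chi R I G *
      (condE S (fun z => (z u == r)%:R * (agree I G z)%:R) x -
       condE S (fun z => (z u == r)%:R) x * condE S (fun z => (agree I G z)%:R) x))).
    apply: eq_bigr => r _; rewrite mulr_sumr; apply: eq_bigr => G _.
    rewrite -mulrA /q !condPE; congr (_ * (_ * (_ - _))).
    by apply: eq_condE => z _; rewrite -natrM mulnb.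
  transitivity (\sum_(r : bool) spin R r * (2 ^+ (n - #|I|) *
      (condE S (fun z => (z u == r)%:R * chi R I z) x -
       condE S (fun z => (z u == r)%:R) x * condE S (chi R I) x))).
    apply: eq_bigr => r _; congr (_ * _).
    under eq_bigr do rewrite mulrBr [X in _ - X]mulrCA.
    rewrite sumrB -mulr_sumr -!condE_sum mulrBr [X in _ = _ - X]mulrCA.
    rewrite -!(condEZ _ (2 ^+ (n - #|I|))).
    congr (_ - _ * _).
      apply: eq_condE => z _; under eq_bigr do rewrite mulrCA.
      by rewrite -mulr_sumr sum_agree_chi mulrCA.
    by apply: eq_condE => z _; rewrite sum_agree_chi.
  under eq_bigr do rewrite mulrCA mulrBr [X in _ - X]mulrA.
  rewrite -mulr_sumr; congr (_ * _).
  rewrite sumrB -mulr_suml -!condE_sum /condcov [condE S (chi R I) x * _]mulrC.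
  congr (_ - _ * _); apply: eq_condE => z _; last exact: spinE.
  under eq_bigr do rewrite mulrA.
  by rewrite -mulr_suml spinE mulrC.
have -> : 2^-1 * \sum_(r : bool) (2 ^+ n)^-1 * \sum_(G : cfg n) \sum_(x : cfg n)
    probX M x * `|q r G x| = (2 ^+ n.+1)^-1 *
    \sum_x probX M x * \sum_(r : bool) \sum_(G : cfg n) `|q r G x|.
  rewrite -mulr_sumr mulrA -invfM -exprS; congr (_ * _).
  under [RHS]eq_bigr do (rewrite mulr_sumr; under eq_bigr do rewrite mulr_sumr).
  by rewrite [RHS]exchange_big /=; apply: eq_bigr => r _; rewrite exchange_big.
have cI : (#|I| <= n)%N by rewrite -[leqRHS]card_ord max_card.
have -> : (2 ^+ #|I|.+1)^-1 = (2 ^+ n.+1)^-1 * 2 ^+ (n - #|I|) :> R.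
  rewrite -[X in (2 ^+ X.+1)^-1 * _](subnKC cI) -addSn exprD invfM -mulrA.
  by rewrite mulVf ?mulr1.
rewrite -mulrA ler_pM2l ?invr_gt0 ?exprn_gt0 // mulr_sumr; apply: ler_sum => x _.
rewrite mulrCA ler_pM2l ?probX_gt0 //.
rewrite -[2 ^+ (n - _)]ger0_norm ?exprn_ge0 // -normrM -key.
apply: le_trans (ler_norm_sum _ _ _) _; apply: ler_sum => r _.
apply: le_trans (ler_norm_sum _ _ _) _; apply: ler_sum => G _.
by rewrite normrM normrM normr_spin normr_chi !mul1r.
Qed.

End Conditioning.

(** * A large covariance at [u], and its form as a mixture over latent patterns *)

Section Influence.
Variables (R : realType) (n m : nat) (M : RBM R n m).
Variables (u : 'I_n) (S : {set 'I_n}).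
Hypothesis uS : u \notin S.
Implicit Types (x z : cfg n) (y : cfg m) (A B I J T : {set 'I_n}) (i : 'I_n).

Notation gamma := (param_gamma M).
Notation E := (local_field M u).
Notation Ebar := (condE M S E).
Notation X_u := (fun z : cfg n => spin R (z u)).

Lemma mem_nbhd T i : u \in T -> i \in T -> i != u -> fhat M T != 0 -> i \in nbhd M u.
Proof.
by move=> uT iT iu fT; rewrite inE iu; apply/existsP; exists T; rewrite uT iT.
Qed.

Lemma condE_invariant F i : i \notin S -> invariant_at i (condE M S F).
Proof.
move=> iS x; apply/esym/condE_agree.
by rewrite agree_flip1 // agree_refl.
Qed.

(** Given the other spins, X_u has mean tanh of the local field; the residual does not depend on
    spin [u], as [u] lies outside [S]. Hence [sum_tilt] applies. *)
Lemma sum_resid_spin : \sum_x probX M x * ((E x - Ebar x) * spin R (x u)) =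
  \sum_x probX M x * ((E x - Ebar x) * thyp (E x)).
Proof.
pose c x := expR (\sum_(T : {set 'I_n} | u \notin T) fhat M T * chi R T x) /
  partition_fn M * (E x - Ebar x).
have pE x t : probX M x * ((E x - Ebar x) * t) =
    c x * expR (spin R (x u) * E x) * t.
  by rewrite probXE (fX_local_field M u) expRD /c; ring.
under eq_bigr do rewrite pE.
under [RHS]eq_bigr do rewrite pE.
apply: sum_tilt; last exact: local_field_invariant.
move=> x; rewrite /c local_field_invariant condE_invariant //.
congr (expR _ / _ * _); apply: eq_bigr => T uT.
by rewrite chi_flip1 (negbTE uT) mul1r.
Qed.

Lemma sum_condcov_ge :
  expR (- (4 * gamma)) * \sum_x probX M x * (E x - Ebar x) ^+ 2 <=
  \sum_x probX M x * condcov M S E X_u x.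
Proof.
rewrite sum_condcov sum_resid_spin.
(* Being a function of X_S, tanh Ebar is orthogonal to the residual. Subtracting it produces an
   increment of tanh, bounded pointwise by [thyp_increment]. *)
have h0 : \sum_x probX M x * ((E x - Ebar x) * thyp (Ebar x)) = 0.
  under eq_bigr do rewrite mulrBl mulrBr.
  rewrite sumrB; apply/eqP; rewrite subr_eq0; apply/eqP/esym.
  by apply: sum_condE => x z xz; rewrite (condE_agree _ _ xz).
have -> : \sum_x probX M x * ((E x - Ebar x) * thyp (E x)) =
    \sum_x probX M x * ((E x - Ebar x) * (thyp (E x) - thyp (Ebar x))).
  by rewrite -[LHS]subr0 -[X in _ - X]h0 -sumrB; apply: eq_bigr => x _; ring.
rewrite mulr_sumr; apply: ler_sum => x _.
rewrite mulrCA ler_pM2l ?probX_gt0 //.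
apply: thyp_increment; first exact: local_field_le_gamma.
by apply: normr_condE_le => z; exact: local_field_le_gamma.
Qed.

(* Averaging over all flips inside the neighborhood costs the stated exponential
   factor; afterwards [chi (T :\ u)] is orthogonal to everything else. *)
Lemma residual_variance_ge T i :
  u \in T -> i \in T -> i != u -> i \notin S -> fhat M T != 0 ->
  expR (- (2 * gamma * #|nbhd M u|%:R)) * fhat M T ^+ 2 <=
  \sum_x probX M x * (E x - Ebar x) ^+ 2.
Proof.
move=> uT iT iu iS fT; set A := nbhd M u; set e := expR _.
pose phi x := (E x - Ebar x) ^+ 2; pose c := fhat M T.
have iA : i \in A by exact: mem_nbhd fT.
have cardA0 : 0 < #|powerset A|%:R :> R.
  by rewrite ltr0n; apply/card_gt0P; exists A; rewrite inE.
have avg x : #|powerset A|%:R * c ^+ 2 <= \sum_(B in powerset A) phi (flip B x).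
  pose psi z := (E z - Ebar z) * chi R (T :\ u) z.
  have spsi : \sum_(B in powerset A) psi (flip B x) = #|powerset A|%:R * c.
    under eq_bigr do rewrite /psi mulrBl.
    (* [Ebar] ignores spin [i], which is outside [S], while [chi (T :\ u)] is odd in it, so this
       part averages to zero. *)
    rewrite sumrB [X in _ - X](@sum_flip_antisym _ _ A i
      (fun z => Ebar z * chi R (T :\ u) z)) //; last first.
      move=> z; rewrite condE_invariant // chi_flip1 !inE iu iT /=; ring.
    rewrite subr0 /local_field; under eq_bigr do rewrite mulr_suml.
    rewrite exchange_big /= (bigD1 T) //= [X in _ + X]big1 ?addr0.
      under eq_bigr do rewrite -mulrA mul_chi mulr1.
      by rewrite sumr_const mulr_natl.
    move=> T' /andP[uT' TT'].
    have [->|fT'] := eqVneq (fhat M T') 0.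
      by rewrite big1 // => B _; rewrite !mul0r.
    (* A spin [k] on which [T] and [T'] differ makes the product of their characters odd. Since both
       coefficients are nonzero, [k] is a neighbor of [u], hence among the spins being flipped. *)
    have /existsP[k kT] : [exists k, (k \in T') != (k \in T)].
      apply: contraNT TT'; rewrite negb_exists => /forallP h.
      by apply/eqP/setP => k; apply/eqP; rewrite -[_ == _]negbK.
    have ku : k != u by apply: contraNneq kT => ->; rewrite uT uT'.
    have kA : k \in A.
      have [kT1|kT1] := boolP (k \in T); first exact: mem_nbhd fT.
      by move: kT; rewrite (negbTE kT1) eqbF_neg negbK => kT2; exact: mem_nbhd fT'.
    apply: (@sum_flip_antisym _ _ A k
      (fun z => fhat M T' * chi R (T' :\ u) z * chi R (T :\ u) z)) => // z.
    rewrite !chi_flip1 !inE ku /=; move: kT.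
    by case: (k \in T) (k \in T') => [] [] //= _; ring.
  (* Cauchy-Schwarz by hand: (a b - c)^2 >= 0 with b^2 = 1 gives a^2 >= 2 c a b - c^2, whose average
     over the flips is c^2. *)
  apply: (@le_trans _ _ (\sum_(B in powerset A) (2 * c * psi (flip B x) - c ^+ 2))).
    by rewrite sumrB -mulr_sumr spsi sumr_const -mulr_natl; lra.
  apply: ler_sum => B _; rewrite /psi /phi.
  set a := E _ - _; set b := chi _ _ _.
  have bb : b * b = 1 by exact: mul_chi.
  have := sqr_ge0 (a * b - c).
  have -> : (a * b - c) ^+ 2 = a ^+ 2 * (b * b) - (2 * c * (a * b) - c ^+ 2) by ring.
  by rewrite bb mulr1 subr_ge0.
rewrite -(ler_pM2l cardA0).
(* Each flip permutes the configurations, so the expectation may be averaged over [B];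
   [probX_flip_ge] then bounds the shifted weights. *)
have -> : #|powerset A|%:R * \sum_x probX M x * phi x =
    \sum_(B in powerset A) \sum_x probX M (flip B x) * phi (flip B x).
  rewrite mulr_natl -sumr_const; apply: eq_bigr => B _.
  by rewrite (sum_flip B (fun x => probX M x * phi x)).
rewrite exchange_big /=.
apply: (@le_trans _ _ (\sum_x e * probX M x * (#|powerset A|%:R * c ^+ 2))).
  by rewrite -mulr_suml -mulr_sumr sum_probX mulr1 mulrCA.
apply: ler_sum => x _; apply: le_trans (ler_wpM2l _ (avg x)) _.
  by rewrite mulr_ge0 ?expR_ge0 // ltW ?probX_gt0.
rewrite mulr_sumr; apply: ler_sum => B; rewrite inE => BA.
by apply: ler_wpM2r; [exact: sqr_ge0 | exact: probX_flip_ge].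
Qed.

(** Expanding the local field bounds the mean of Cov(E, X_u | X_S) by the sum of |fhat T'| K(T'),
    hence by gamma times the largest K. A set [T0] containing a neighbor outside [S] gives the lower
    bound; the maximizer [T] may be a different set. *)
Lemma exists_large_cov : ~~ (nbhd M u \subset S) ->
  exists T : {set 'I_n}, [/\ u \in T, fhat M T != 0, 0 < gamma &
   expR (- (4 * gamma)) * expR (- (2 * gamma * (param_D M)%:R)) * param_alpha M ^+ 2
   <= gamma * cov_norm M S u (T :\ u :\: S)].
Proof.
move=> /subsetPn[i]; rewrite inE => /andP[iu /existsP[T0 /and3P[uT0 iT0 fT0]]] iS.
pose K T := cov_norm M S u (T :\ u :\: S).
pose P T := (u \in T) && (fhat M T != 0).
have PT0 : P T0 by rewrite /P uT0 fT0.
case: (@Order.TotalTheory.arg_maxP _ _ _ T0 P K PT0) => T /andP[uT fT] maxT.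
exists T; split => //.
  apply: lt_le_trans (sum_fhat_le_gamma M u).
  rewrite (bigD1 T) //= ltr_pwDl ?normr_gt0 // sumr_ge0 //.
have K0 T' : 0 <= K T'.
  by rewrite sumr_ge0 // => x _; rewrite mulr_ge0 // ltW ?probX_gt0.
apply: (@le_trans _ _ (\sum_x probX M x * condcov M S E X_u x)).
  apply: le_trans sum_condcov_ge; rewrite -mulrA ler_pM2l ?expR_gt0 //.
  apply: le_trans (residual_variance_ge uT0 iT0 iu iS fT0).
  apply: ler_pM; rewrite ?expR_ge0 ?sqr_ge0 //.
    rewrite ler_expR lerN2 ler_wpM2l ?mulr_ge0 ?param_gamma_ge0 // ler_nat.
    exact: (leq_bigmax (F := fun v => #|nbhd M v|)).
  rewrite -[leRHS]real_normK ?num_real // ler_sqr ?nnegrE ?param_alpha_ge0 //.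
  exact: param_alpha_le.
under eq_bigr do rewrite condcov_sum mulr_sumr.
rewrite exchange_big /=.
apply: (@le_trans _ _ (\sum_(T' : {set 'I_n} | u \in T') `|fhat M T'| * K T)).
  apply: ler_sum => T' uT'.
  have [f0|fT'] := eqVneq (fhat M T') 0.
    by rewrite big1 ?mulr_ge0 // => x _; rewrite f0 mul0r mulr0.
  apply: (@le_trans _ _ (`|fhat M T'| * K T')); last first.
    by apply: ler_wpM2l => //; apply: maxT; rewrite /P uT'.
  rewrite mulr_sumr; apply: ler_sum => x _.
  apply: le_trans (ler_norm _) _.
  rewrite [leLHS]normrM (gtr0_norm (probX_gt0 M x)) [`|fhat M T' * _|]normrM.
  by rewrite -(normr_condcov_chi M S (T' :\ u)) mulrCA.
by rewrite -mulr_suml ler_wpM2r // sum_fhat_le_gamma.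
Qed.

(** Given the latents, the spins in [J] are independent of each other and of [F]; they are averaged
    out one at a time by [sum_tilt]. *)
Lemma sum_joint_weight_chi (F : cfg n -> R) J y :
  (forall i, i \in J -> invariant_at i F) ->
  \sum_z joint_weight M z y * F z * chi R J z =
  (\prod_(i in J) thyp (visible_field M i y)) * \sum_z joint_weight M z y * F z.
Proof.
move kJ: #|J| => k; elim: k => [|k IH] in J F kJ *.
  move/eqP: kJ; rewrite cards_eq0 => /eqP -> _.
  rewrite big_set0 mul1r; apply: eq_bigr => z _.
  by rewrite /chi big_set0 mulr1.
move=> Fi; have /card_gt0P[i iJ] : (0 < #|J|)%N by rewrite kJ.
have kJi : #|J :\ i| = k by move: kJ; rewrite (cardsD1 i) iJ => -[].
rewrite (big_setD1 i iJ) /= -mulrA -IH //; last first.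
  by move=> j; rewrite inE => /andP[_]; exact: Fi.
pose a := visible_field M i y.
pose c z := expR (\sum_(j | j != i) spin R (z j) * visible_field M j y +
   \sum_j rg M j * spin R (y j)) * F z * chi R (J :\ i) z.
have wE z t : joint_weight M z y * F z * (t * chi R (J :\ i) z) =
    c z * expR (spin R (z i) * a) * t.
  by rewrite joint_weightE (bigD1 i) //= -addrA expRD /c /a; ring.
transitivity (\sum_z c z * expR (spin R (z i) * a) * spin R (z i)).
  by apply: eq_bigr => z _; rewrite -wE -chiS.
rewrite (@sum_tilt _ _ i c (fun=> a)) //.
  by rewrite mulr_sumr; apply: eq_bigr => z _; rewrite -wE /a; ring.
move=> z; rewrite /c Fi // chi_flip1 !inE eqxx mul1r.
rewrite (eq_bigr (fun j => spin R (z j) * visible_field M j y)) // => j ji.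
by rewrite flip1_neq.
Qed.

Definition latents : {set 'I_m} :=
  [set j | [exists i in nbhd M u, rJ M i j != 0]].

(** The set [c] lists the latents equal to +1. Latents outside [latents] get -1 when [c] is a subset
    of it; this choice is harmless, since they have zero weight to every neighbor of [u]. *)
Definition cond_mean i (c : {set 'I_m}) : R :=
  thyp (visible_field M i [ffun j => j \in c]).

(** Insert the latents, average out the spins of [J], and group the latent configurations by their
    restriction to [latents]. One [w] serves every [J], as [mixnorm_le] compares different [J] for
    the same weights. *)
Lemma cov_norm_mixture : exists w : cfg n -> {set 'I_m} -> R,
  forall J, J \subset nbhd M u -> [disjoint J & S] ->
  cov_norm M S u J = mixnorm cond_mean w (powerset latents) J.
Proof.
pose F x z := (agree S x z)%:R * (spin R (z u) - condE M S X_u x).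
pose cf x := probX M x / probE M (agree S x) / partition_fn M.
pose pr (y : cfg m) := [set j in latents | y j].
exists (fun x c => cf x * \sum_(y | pr y == c) \sum_z joint_weight M z y * F x z).
move=> J JN dJS; rewrite /cov_norm /mixnorm; apply: eq_bigr => x _.
rewrite -{1}(gtr0_norm (probX_gt0 M x)) -normrM condcovE; congr `| _ |.
have FJ i : i \in J -> invariant_at i (F x).
  move=> iJ z; have iS := negbT (disjointFr dJS iJ).
  rewrite /F agree_flip1 // flip1_neq // eq_sym.
  by have := fintype.subsetP JN i iJ; rewrite inE => /andP[].
have pE i y : i \in J -> thyp (visible_field M i y) = cond_mean i (pr y).
  move=> iJ; rewrite /cond_mean /visible_field; congr thyp; congr (_ + _).
  apply: eq_bigr => j _; rewrite ffunE inE.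
  have [//|jL] := boolP (j \in latents).
  suff -> : rJ M i j = 0 by rewrite !mul0r.
  apply/eqP; apply: contraNT jL => Jij; rewrite inE.
  apply/exists_inP; exists i => //.
  exact: (fintype.subsetP JN).
transitivity (cf x * \sum_y \sum_z joint_weight M z y * F x z * chi R J z).
  have -> : \sum_y \sum_z joint_weight M z y * F x z * chi R J z =
      partition_fn M * \sum_(z | agree S x z)
        probX M z * ((spin R (z u) - condE M S X_u x) * chi R J z).
    rewrite exchange_big /= mulr_sumr [RHS]big_mkcond; apply: eq_bigr => z _.
    have Wz : \sum_y joint_weight M z y = probX M z * partition_fn M.
      by rewrite /probX mulfVK // gt_eqF ?partition_fn_gt0.
    rewrite -!mulr_suml Wz /F.
    by case: (agree S x z) => /=; ring.
  rewrite /cf {1}/condE; field.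
  by rewrite !gt_eqF ?partition_fn_gt0 ?probE_agree_gt0.
under eq_bigr do rewrite sum_joint_weight_chi //.
rewrite (partition_big pr (fun c => c \in powerset latents)) /=; last first.
  by move=> y _; rewrite inE; apply/fintype.subsetP => j; rewrite inE => /andP[].
rewrite mulr_sumr; apply: eq_bigr => c _; rewrite -mulrA; congr (_ * _).
rewrite mulr_suml; apply: eq_bigr => y /eqP <-; rewrite mulrC; congr (_ * _).
by apply: eq_bigr => i; exact: pE.
Qed.

End Influence.

(** * Comparison of constants and conclusion *)

(** The first two factors are at most 1. With q = e^(-2g), the rest follows from q^(d+D) <= q^(2+D)
    and 4 * 6^d <= 2 * 32^d <= 2^(d+1) d^(4d), both using d >= 2. *)
Lemma theorem3_bound_le (R : realType) (a g : R) (d D N N' c : nat) :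
  0 < g -> (1 < d)%N ->
  ((4 * d)%:R ^+ N)^-1 * (d%:R^-1) ^+ N' *
  ((4 * a ^+ 2 * (expR (- (2 * g))) ^+ (d + D - 1)) /
   (d%:R ^+ (4 * d) * 2 ^+ (d + 1) * c%:R * g * expR (2 * g))) <=
  expR (- (4 * g)) * expR (- (2 * g * D%:R)) * a ^+ 2 / (6 ^+ d * g).
Proof.
move=> g0 d2; have d0 : (0 < d)%N by exact: ltnW.
move: (a ^+ 2) (sqr_ge0 a) => b b0.
have e0 (t : R) : 0 < expR t by exact: expR_gt0.
set Q := (_ / (d%:R ^+ _ * _ * _ * _ * _)); set X := (X in _ <= X).
have X0 : 0 <= X.
  by rewrite /X ?(divr_ge0, mulr_ge0, exprn_ge0, expR_ge0) // ltW.
have Q0 : 0 <= Q.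
  by rewrite /Q ?(divr_ge0, mulr_ge0, exprn_ge0, expR_ge0) // ltW.
apply: (@le_trans _ _ Q).
  apply: ler_piMl => //; apply: mulr_ile1.
  - by rewrite invr_ge0 exprn_ge0.
  - by rewrite exprn_ge0 // invr_ge0.
  - by rewrite invf_le1 ?exprn_gt0 ?ltr0n ?muln_gt0 // exprn_ege1 // ler1n muln_gt0.
  - by rewrite exprn_ile1 ?invr_ge0 // invf_le1 ?ltr0n // ler1n.
(* [c] stands for the binomial coefficient; if it is 0, division by zero makes [Q] equal to 0. *)
have [c00|c0] := posnP c; first by rewrite /Q c00 mulr0 !mul0r invr0 mulr0.
pose q := expR (- (2 * g)).
have q1 : q <= 1 by rewrite /q expR_le1; lra.
have -> : X = b * q ^+ (2 + D) / g * (6 ^+ d)^-1.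
  have q2 : expR (- (4 * g)) = q ^+ 2 by rewrite -expRM_natl; congr expR; ring.
  have qD : expR (- (2 * g * D%:R)) = q ^+ D.
    by rewrite -expRM_natl; congr expR; ring.
  by rewrite /X q2 qD exprD invfM; ring.
have -> : Q = b * q ^+ (d + D) / g * (4 / (d%:R ^+ (4 * d) * 2 ^+ (d + 1) * c%:R)).
  have -> : (d + D = (d + D - 1).+1)%N by rewrite subn1 prednK // addn_gt0 d0.
  rewrite /Q /q exprSr expRN; field.
  by rewrite !gt_eqF ?expf_neq0 ?ltr0n ?exprn_gt0 ?ltr0n.
apply: ler_pM.
- by rewrite ?(divr_ge0, mulr_ge0, exprn_ge0, expR_ge0) // ltW.
- by rewrite ?(divr_ge0, mulr_ge0, exprn_ge0).
- rewrite ler_pM2r ?invr_gt0 // ler_wpM2l // ler_wiXn2l ?expR_ge0 //.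
  by rewrite leq_add2r.
rewrite ler_pdivrMr ?mulr_gt0 ?exprn_gt0 ?ltr0n //.
rewrite mulrC ler_pdivlMr ?exprn_gt0 //.
rewrite -!natrX -!natrM ler_nat.
apply: (@leq_trans (2 * 32 ^ d)).
  rewrite -(prednK d0) !expnS !mulnA; apply: leq_mul => //.
  by rewrite leq_exp2r // -subn1 subn_gt0.
have h16 : (16 ^ d <= d ^ (4 * d))%N.
  by rewrite expnM leq_exp2r // (@leq_exp2r 2 d 4).
rewrite addn1 expnS mulnCA -mulnA leq_mul2l /= (expnMn 16 2 d) -mulnA.
by apply: leq_mul => //; rewrite leq_pmulr.
Qed.

Theorem theorem3 (R : realType) (n m : nat) (M : RBM R n m)
  (u : 'I_n) (S : {set 'I_n}) :
  u \notin S ->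
  ~~ (nbhd M u \subset S) ->
  exists I : {set 'I_n},
    [/\ I \subset nbhd M u, (#|I| <= 2 ^ param_s M)%N, [disjoint I & S] &
        theorem3_bound M <= nu M u I S].
Proof.
move=> uS NS; have [T [uT fT g0 hT]] := exists_large_cov uS NS.
have d2 : (1 < param_d M)%N.
  have /subsetPn[i] := NS; rewrite inE.
  move=> /andP[iu /existsP[T0 /and3P[uT0 iT0 fT0]]] _.
  have T1 : (1 < #|T0|)%N.
    apply: (@leq_trans #|[set u; i]|); first by rewrite cards2 eq_sym iu.
    by apply: subset_leq_card; rewrite finset.subUset !finset.sub1set uT0.
  exact: leq_trans T1 (fhat_degree_le fT0 T1).
have dT : (#|T| <= param_d M)%N.
  case: (leqP #|T| 1) => [T1|]; last exact: fhat_degree_le.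
  exact: leq_trans T1 (ltnW d2).
set I0 := T :\ u :\: S in hT.
(* Strict because [u] was removed from [T]; this absorbs the extra 1 in the factor 2^(|J|+1) of
   [cov_norm_le_nu]. *)
have I0d : (#|I0| < param_d M)%N.
  apply: leq_trans dT; rewrite (cardsD1 u T) uT ltnS.
  exact/subset_leq_card/finset.subsetDl.
have I0N : I0 \subset nbhd M u.
  apply/fintype.subsetP => i /setDP[/setD1P[iu iT] _].
  exact: mem_nbhd fT.
have I0S : [disjoint I0 & S].
  rewrite -setI_eq0; apply/eqP/setP => i; rewrite !inE.
  by case: (i \in S); rewrite ?andbF.
have [w hw] := cov_norm_mixture M u S.
have subI0 (J : {set 'I_n}) : J \subset I0 -> J \subset nbhd M u /\ [disjoint J & S].
  move=> JI; split; first exact: fintype.subset_trans JI I0N.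
  exact: disjointWl JI I0S.
pose P (J : {set 'I_n}) := (J \subset I0) && (#|J| <= #|powerset (latents M u)|)%N.
have P0 : P finset.set0 by rewrite /P finset.sub0set cards0.
(* With [J] the best small subset of [I0], its [cov_norm] is the uniform bound [e] required by
   [mixnorm_le]. *)
case: (@Order.TotalTheory.arg_maxP _ _ _ finset.set0 P (cov_norm M S u) P0)
  => J /andP[JI JL] maxJ.
have [JN JS] := subI0 J JI.
have KI : cov_norm M S u I0 <= 3 ^+ #|I0| * cov_norm M S u J.
  rewrite hw //; apply: mixnorm_le => [i c|J' J'I J'L]; first exact: normr_thyp_le1.
  have [J'N J'S] := subI0 J' J'I.
  by rewrite -hw //; apply: maxJ; rewrite /P J'I.
exists J; split => //.
  apply: leq_trans JL _; rewrite card_powerset leq_pexp2l //.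
  exact: (leq_bigmax
    (F := fun v => #|[set j : 'I_m | [exists i in nbhd M v, rJ M i j != 0]]|)).
apply: le_trans (cov_norm_le_nu M S u J).
apply: le_trans (@theorem3_bound_le _ _ _ _ _ _ _ _ g0 d2) _.
set d := param_d M in I0d d2 *.
have K0 : 0 <= cov_norm M S u J.
  by rewrite sumr_ge0 // => x _; rewrite mulr_ge0 // ltW ?probX_gt0.
have Jd : (#|J| < d)%N by apply: leq_ltn_trans I0d; exact: subset_leq_card.
rewrite ler_pdivrMr ?mulr_gt0 ?exprn_gt0 //; apply: le_trans hT _.
rewrite mulrA [leRHS]mulrC ler_pM2l //; apply: le_trans KI _.
(* The losses 3^|I0| from shrinking the set and 2^(|J|+1) from passing to [nu] are at most 3^d and
   2^d, together 6^d. *)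
apply: (@le_trans _ _ (3 ^+ d * cov_norm M S u J)).
  by rewrite ler_wpM2r // ler_weXn2l ?ler1n // ltnW.
rewrite mulrAC ler_wpM2r // mulrC ler_pdivlMr ?exprn_gt0 //.
have -> : (6 : R) = 3 * 2 by ring.
by rewrite exprMn ler_pM2l ?exprn_gt0 // ler_weXn2l ?ler1n.
Qed.
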